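(* Let $G=(V,E,\mu,\omega)$ be a connected weighted graph with Laplacian $\Delta$, let $p\in V$, and let $T\in(0,\infty]$. Let $u$ be a solution of the heat equation $\partial_t u-\Delta u=0$ on $V\times[-T,0]$ satisfying $$|u(x,t)|\leq A_1e^{A_2\,d(x,p)\ln d(x,p)}\qquad\text{for all }(x,t)\in V\times[-T,0],$$ where $A_1,A_2$ are positive constants with $A_2\le 1$. Assume that for some constant $D>0$, $$\sup_{x\in V}\mathrm{Deg}(x)\leq D.$$ Then $u$ is analytic in $t\in[-T,0]$ with radius $r>0$, where $r=+\infty$ if $A_2<1$, and $r\geq\frac{1}{2eD}$ if $A_2=1$. Moreover, for every $x\in V$ and every $t\in(-r,0]\cap[-T,0]$, $$u(x,t)=\sum_{k=0}^\infty a_k(x)\frac{t^k}{k!},$$ where the functions $a_k:V\to\mathbb R$ satisfy $\Delta a_k(x)=a_{k+1}(x)$ and $$|a_k(x)|\leq A_1(2D)^k e^{A_2\,(k+d(x,p))\ln(k+d(x,p))}\qquad\text{for all }x\in V,\ k=0,1,2,\dots$$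
   Context: A weighted graph $G=(V,E,\mu,\omega)$ consists of a locally finite, simple, undirected graph $(V,E)$, a vertex weight $\mu:V\to(0,\infty)$, $x\mapsto\mu_x$, and a symmetric edge weight $\omega:E\to(0,\infty)$, $\{x,y\}\mapsto\omega_{xy}=\omega_{yx}$, extended to $V\times V$ by $\omega_{xy}=0$ if $\{x,y\}\notin E$. Write $x\sim y$ if $\{x,y\}\in E$. For $f:V\to\mathbb R$, the Laplacian is $\Delta f(x)=\sum_{y\in V}\frac{\omega_{xy}}{\mu_x}(f(y)-f(x))$. The weighted degree is $\mathrm{Deg}(x)=\sum_{y\in V}\frac{\omega_{xy}}{\mu_x}$. The combinatorial distance is $d(x,y)=\inf\{n: x=z_0\sim z_1\sim\cdots\sim z_n=y\}$; the graph is connected, so $d$ is finite. Convention: $0\ln 0=0$. For $T=\infty$, $[-T,0]$ means $(-\infty,0]$. For functions $u:V\times[-T,0]\to\mathbb R$, $\Delta$ acts in the variable $x$, and time derivatives at endpoints of the time interval are one-sided. ''$u$ is analytic in $t\in[-T,0]$ with radius $r\in(0,\infty]$'' means: for every $x\in V$, $u(x,\cdot)$ is infinitely differentiable on $[-T,0]$, and for every $t_0\in[-T,0]$ and every $t\in[-T,0]$ with $|t-t_0|<r$ one has $u(x,t)=\sum_{k=0}^\infty \partial_t^k u(x,t_0)\frac{(t-t_0)^k}{k!}$, the series being convergent. *)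

(* Defs.v *)
From mathcomp Require Import all_boot all_order all_algebra.
From mathcomp Require Import all_classical all_reals all_analysis.

Set Implicit Arguments.
Unset Strict Implicit.
Unset Printing Implicit Defensive.

Import Order.TTheory GRing.Theory Num.Theory.
Import numFieldNormedType.Exports.

Local Open Scope classical_set_scope.
Local Open Scope ring_scope.

Record weighted_graph (R : realType) (V : choiceType) := WeightedGraph {
  adj : rel V;
  adj_sym : forall x y, adj x y = adj y x;
  adj_irrefl : forall x, ~~ adj x x;
  adj_locally_finite : forall x, finite_set [set y | adj x y];
  mu : V -> R;
  mu_gt0 : forall x, 0 < mu x;
  omega : V -> V -> R;
  omega_sym : forall x y, omega x y = omega y x;
  omega_gt0 : forall x y, adj x y -> 0 < omega x y;
  omega_eq0 : forall x y, ~~ adj x y -> omega x y = 0 }.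

Section WeightedGraph.
Context {R : realType} {V : choiceType} (G : weighted_graph R V).

(* The sums over [set: V] below have finite support, because [omega G x] vanishes
   off the finite set of neighbours of [x]. *)
Definition laplacian (f : V -> R) (x : V) : R :=
  \sum_(y \in [set: V]) omega G x y / mu G x * (f y - f x).

Definition weighted_degree (x : V) : R :=
  \sum_(y \in [set: V]) omega G x y / mu G x.

Definition walk (x y : V) (n : nat) : Prop :=
  exists s : seq V, [/\ path (adj G) x s, last x s = y & size s = n].

Definition connected_graph : Prop := forall x y, exists n, walk x y n.

(* Junk value 0 when [x] and [y] are not joined by a walk. *)
Definition dist (x y : V) : nat :=
  if pselect (exists n, `[< walk x y n >]) is left h then ex_minn h else 0%N.

End WeightedGraph.

(* Calculus relative to a set [I]: at an endpoint of an interval [I] these are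
   the one-sided notions, and only the values of [f] on [I] matter. *)
Section DeriveOn.
Context {R : realType}.
Implicit Types (I : set R) (f : R -> R) (t : R).

Definition diff_quotient f t : R -> R := fun s => (f s - f t) / (s - t).

Definition derivable_on I f t : Prop :=
  cvg (diff_quotient f t @ within I t^').

Definition derive_on I f t : R := lim (diff_quotient f t @ within I t^').

Definition derive_on_n I (k : nat) f : R -> R := iter k (derive_on I) f.

Definition smooth_on I f : Prop :=
  forall (k : nat) t, I t -> derivable_on I (derive_on_n I k f) t.

End DeriveOn.

Section HeatEquation.
Context {R : realType} {V : choiceType}.
Implicit Types (T r : \bar R) (u : V -> R -> R).

(* The interval [-T, 0], which is ]-oo, 0] when T = +oo. *)
Definition time_interval T : set R := [set t | (- T <= t%:E)%E /\ t <= 0].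

Definition heat_solution (G : weighted_graph R V) T u : Prop :=
  forall x t, time_interval T t ->
    derivable_on (time_interval T) (u x) t /\
    derive_on (time_interval T) (u x) t - laplacian G (u ^~ t) x = 0.

Definition analytic_in_time T r u : Prop :=
  forall x,
    smooth_on (time_interval T) (u x) /\
    forall t0 t, time_interval T t0 -> time_interval T t ->
      (`|t - t0|%:E < r)%E ->
      [series derive_on_n (time_interval T) k (u x) t0
              * ((t - t0) ^+ k / k`!%:R)]_k @ \oo --> u x t.

End HeatEquation.

(* The function [n |-> e^(A n ln n)]; the convention [0 ln 0 = 0] holds since
   [ln 0] is a real number here. *)
Definition exp_nlogn {R : realType} (A : R) (n : nat) : R :=
  expR (A * (n%:R * ln n%:R)).

(* Main.v *)
(* The time derivatives of a solution are [d_t^k u = Delta^k u].  A bound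
   [Deg <= D] makes each application of [Delta] cost a factor [2 D] and one more
   step of distance, so [|d_t^k u| <= A1 (2 D)^k e^(A2 (k + d) ln (k + d))] with
   [d = d(x, p)].  Inserted in the Taylor remainder at order [n], this gives
   [A1 (2 D |t - t0|)^n e^(A2 (n + d) ln (n + d)) / n!], whose ratio of
   consecutive terms tends to [0] if [A2 < 1] and to [2 e D |t - t0|] if
   [A2 = 1]. *)

Require Import Defs.
From mathcomp Require Import all_boot all_order all_algebra.
From mathcomp Require Import finmap.
From mathcomp Require Import all_classical all_reals all_analysis.
From mathcomp Require Import ring lra zify.

Set Implicit Arguments.
Unset Strict Implicit.
Unset Printing Implicit Defensive.

Import Order.TTheory GRing.Theory Num.Theory.
Import numFieldNormedType.Exports.

Local Open Scope classical_set_scope.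
Local Open Scope ring_scope.

(** * Taylor's formula with a remainder bound on the unit interval *)

Section Taylor.
Context {R : realType}.
Implicit Types (f g : R -> R) (a b x M : R).

(** The difference [g - f] has a nonnegative derivative inside the interval, so it is
    nondecreasing. *)
Lemma le_of_derive_le f g (df dg : R -> R) a b :
  (forall x, x \in `]a, b[%R -> is_derive x 1 f (df x)) ->
  (forall x, x \in `]a, b[%R -> is_derive x 1 g (dg x)) ->
  {within `[a, b], continuous f} -> {within `[a, b], continuous g} ->
  (forall x, x \in `]a, b[%R -> df x <= dg x) -> f a <= g a ->
  forall x, x \in `[a, b]%R -> f x <= g x.
Proof.
move=> Df Dg cf cg dfg fga x xab.
have D y : y \in `]a, b[%R -> is_derive y 1 (g - f) (dg y - df y).
  by move=> yab; apply: is_deriveB; [exact: Dg|exact: Df].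
have ax : a <= x by move: xab; rewrite in_itv => /andP[].
have aab : a \in `[a, b]%R.
  by move: xab; rewrite !in_itv /= lexx /= => /andP[]; exact: le_trans.
suff : (g - f) a <= (g - f) x.
  by rewrite /= => h; rewrite -subr_ge0 (le_trans _ h)// subr_ge0.
apply: (@ger0_derive1_le_cc _ (g - f) a b) => // [y yab|y yab|].
- by case: (D y yab).
- by rewrite derive1E; case: (D y yab) => _ ->; rewrite subr_ge0 dfg.
- exact: within_continuousB.
Qed.

Lemma is_derive_horner (p : {poly R}) x : is_derive x 1 (horner p) p^`().[x].
Proof.
by apply: DeriveDef; [exact: derivable_horner|rewrite derivE derive1E].
Qed.

Lemma deriv_monomial_fact M n :
  ((M / n.+1`!%:R) *: 'X^(n.+1))^`() = (M / n`!%:R) *: 'X^n :> {poly R}.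
Proof.
rewrite derivZ derivXn -scalerMnr scalerMnl; congr (_ *: _); rewrite -mulr_natr.
rewrite factS natrM; field.
by rewrite addrC natr1 !pnatr_eq0 -!lt0n fact_gt0.
Qed.

(** Both [g] and [- g] are compared with the antiderivative of the bound that vanishes at 0. This
    replaces integration in the proof of Taylor's formula. *)
Lemma norm_le_monomial g (dg : R -> R) M n :
  (forall x, x \in `]0, 1[%R -> is_derive x 1 g (dg x)) ->
  {within `[0, 1], continuous g} ->
  (forall x, x \in `]0, 1[%R -> `|dg x| <= M * (x ^+ n / n`!%:R)) -> g 0 = 0 ->
  forall x, x \in `[0, 1]%R -> `|g x| <= M * (x ^+ n.+1 / n.+1`!%:R).
Proof.
move=> Dg cg dgM g0 x x01.
pose p : {poly R} := (M / n.+1`!%:R) *: 'X^(n.+1).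
have Dp (y : R) : is_derive y 1 (horner p) ((M / n`!%:R) *: 'X^n : {poly R}).[y].
  by rewrite -deriv_monomial_fact; exact: is_derive_horner.
have cp : {within `[0, 1], continuous (horner p)}.
  by apply: continuous_subspaceT; exact: continuous_horner.
have dpE y : ((M / n`!%:R) *: 'X^n : {poly R}).[y] = M * (y ^+ n / n`!%:R).
  by rewrite hornerZ hornerXn; ring.
have pE y : p.[y] = M * (y ^+ n.+1 / n.+1`!%:R).
  by rewrite /p hornerZ hornerXn; ring.
have p0 : p.[0] = 0 by rewrite pE expr0n /= mul0r mulr0.
have Ng (y : R) : y \in `]0, 1[%R -> is_derive y 1 (- g) (- dg y).
  by move=> y01; apply: is_deriveN; exact: Dg.
rewrite -pE ler_norml lerNl; apply/andP; split.
- apply: (@le_of_derive_le (- g) (horner p) (fun x => - dg x) _ 0 1) => //.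
  + rewrite -[- g]sub0r; apply: within_continuousB => //.
    by apply: continuous_subspaceT; exact: cst_continuous.
  + move=> y /dgM; rewrite ler_norml lerNl => /andP[h _].
    by rewrite dpE.
  + by rewrite p0 (_ : (- g) 0 = - g 0)// g0 oppr0.
- apply: (@le_of_derive_le g (horner p) dg _ 0 1) => //.
  + move=> y /dgM; rewrite ler_norml => /andP[_ h].
    by rewrite dpE.
  + by rewrite p0 g0.
Qed.

(** Induction on [n]: the derivative of the remainder of order [n.+1] is the remainder of order [n]
    for the shifted family [f k.+1], and [norm_le_monomial] integrates that bound. *)
Lemma taylor_unit_itv n (f : nat -> R -> R) M :
  (forall k x, x \in `]0, 1[%R -> is_derive x 1 (f k) (f k.+1 x)) ->
  (forall k, {within `[0, 1], continuous (f k)}) ->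
  (forall x, x \in `[0, 1]%R -> `|f n x| <= M) ->
  forall x, x \in `[0, 1]%R ->
  `|f 0%N x - \sum_(k < n) f k 0 / k`!%:R * x ^+ k| <= M * (x ^+ n / n`!%:R).
Proof.
elim: n f => [|n IH] f Df cf fM x x01.
  by rewrite big_ord0 subr0 expr0 fact0 divr1 mulr1 fM.
pose p : {poly R} := \poly_(k < n.+1) (f k 0 / k`!%:R).
rewrite -(horner_poly n.+1 (fun k => f k 0 / k`!%:R)) -/p.
have p'E y : p^`().[y] = \sum_(k < n) f k.+1 0 / k`!%:R * y ^+ k.
  rewrite -(horner_poly n (fun k => f k.+1 0 / k`!%:R)); congr (_.[_]).
  apply/polyP => i; rewrite coef_deriv !coef_poly ltnS.
  case: ifP => _; last by rewrite mul0rn.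
  rewrite -mulr_natr factS natrM; field.
  by rewrite addrC natr1 !pnatr_eq0 -!lt0n fact_gt0.
apply: (@norm_le_monomial (f 0%N - horner p)
  (fun y => f 1%N y - p^`().[y])) => //.
- by move=> y y01; apply: is_deriveB; exact: Df.
- apply: within_continuousB => //.
  by apply: continuous_subspaceT; exact: continuous_horner.
- move=> y y01; rewrite p'E.
  apply: (IH (fun k => f k.+1)) => //.
  exact: subset_itv_oo_cc.
- rewrite (_ : (f 0%N - horner p) 0 = f 0%N 0 - p.[0])//.
  by rewrite horner_coef0 coef_poly /= fact0 divr1 subrr.
Qed.

End Taylor.

(** * Derivatives relative to a set, and Taylor's formula for them *)

Section RelativeDerivative.
Context {R : realType}.
Implicit Types (I J : set R) (f : R -> R) (t d l : R).

(** Relational form of the derivative: limits can be combined without first knowing that they are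
    unique. *)
Definition has_derive_on I f t l := diff_quotient f t @ within I t^' --> l.

(** Chain rule for an affine map; [d != 0] makes it injective, so it sends punctured neighbourhoods
    of [t] into punctured neighbourhoods of its image. *)
Lemma has_derive_on_affine I J f t0 d t l : d != 0 ->
  (forall s, J s -> I (t0 + s * d)) ->
  has_derive_on I f (t0 + t * d) l ->
  has_derive_on J (fun s => f (t0 + s * d)) t (l * d).
Proof.
rewrite /has_derive_on => d0 JI H.
have -> : diff_quotient (fun s => f (t0 + s * d)) t =
    (fun s => diff_quotient f (t0 + t * d) (t0 + s * d) * d).
  apply/funext => s; rewrite /diff_quotient.
  have -> : t0 + s * d - (t0 + t * d) = (s - t) * d by ring.
  by rewrite invfM mulrA divfK.
apply: cvgM; last exact: cvg_cst.
apply: (@cvg_comp _ _ _ (fun s => t0 + s * d) (diff_quotient f (t0 + t * d)))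
  H.
have c : {for t, continuous (fun s : R => t0 + s * d)}.
  by apply: cvgD; [exact: cvg_cst|apply: cvgM; [exact: cvg_id|exact: cvg_cst]].
move=> P HP.
have {}HP : \forall s \near t,
    t0 + s * d != t0 + t * d -> I (t0 + s * d) -> P (t0 + s * d).
  exact: (c _ HP).
suff : \forall s \near t, s != t -> J s -> P (t0 + s * d) by [].
near=> s => st Js.
have : t0 + s * d != t0 + t * d -> I (t0 + s * d) -> P (t0 + s * d).
  by near: s.
apply; last exact: JI.
by rewrite (inj_eq (addrI _)) (inj_eq (mulIf d0)).
Unshelve. all: by end_near. Qed.

Lemma has_derive_on_interior I f t l : nbhs t I ->
  has_derive_on I f t l -> is_derive t 1 f l.
Proof.
move=> It H.
have {}H : h^-1 *: ((f \o shift t) (h *: 1) - f t) @[h --> 0^'] --> l.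
  have -> : (fun h : R => h^-1 *: ((f \o shift t) (h *: (1 : R)) - f t)) =
      diff_quotient f t \o shift t.
    apply/funext => h; rewrite /diff_quotient /= [h *: 1]mulr1 addrK.
    by rewrite [LHS]mulrC.
  suff sh : shift t @ 0^' --> within I t^' by exact: cvg_comp sh H.
  move=> P.
  have c : {for (0 : R), continuous (shift t)}.
    by apply: cvgD; [exact: cvg_id|exact: cvg_cst].
  move=> HP.
  have {}HP : \forall h \near (0 : R), h + t != t -> I (h + t) -> P (h + t).
    by apply: (c (fun y => y != t -> I y -> P y)); rewrite /= add0r; exact: HP.
  have It' : \forall h \near (0 : R), I (h + t).
    by apply: (c I); rewrite /= add0r.
  suff : \forall h \near (0 : R), h != 0 -> P (h + t) by [].
  near=> h => h0.
  have : h + t != t -> I (h + t) -> P (h + t) by near: h.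
  apply; last by near: h.
  by rewrite -subr_eq0 addrK.
by apply: DeriveDef; [apply/cvg_ex; exists l|exact: cvg_lim].
Unshelve. all: by end_near. Qed.

(** Off [t], the increment of [f] is the difference quotient times [s - t], which tends to
    [df t * 0]. *)
Lemma has_derive_on_continuous I f (df : R -> R) :
  (forall t, I t -> has_derive_on I f t (df t)) -> {within I, continuous f}.
Proof.
move=> H; apply/subspace_continuousP => t It.
have c : (fun s => diff_quotient f t s * (s - t)) @ within I t^' --> df t * 0.
  apply: cvgM; first exact: H.
  rewrite -(subrr t); apply: cvgB; last exact: cvg_cst.
  apply: cvg_within_filter; apply: cvg_within_filter; exact: cvg_id.
move/cvgrPdist_le in c; apply/cvgrPdist_le => e e0.
have c' : \forall s \near t, s != t -> I s ->
    `|df t * 0 - diff_quotient f t s * (s - t)| <= e.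
  exact: (c e e0).
suff : \forall s \near t, I s -> `|f t - f s| <= e by [].
near=> s => Is.
have [->|st] := eqVneq s t; first by rewrite subrr normr0 ltW.
have : s != t -> I s -> `|df t * 0 - diff_quotient f t s * (s - t)| <= e.
  by near: s.
move=> /(_ st Is); rewrite mulr0 sub0r normrN /diff_quotient divfK ?subr_eq0//.
by rewrite distrC.
Unshelve. all: by end_near. Qed.

(* Along the affine path from [t0] to [t] the relative derivatives become ordinary
   ones on ]0, 1[, whatever the order of [t0] and [t]. *)
Lemma taylor_has_derive_on I (f : nat -> R -> R) n M t0 t :
  is_interval I -> I t0 -> I t ->
  (forall k s, I s -> has_derive_on I (f k) s (f k.+1 s)) ->
  (forall s, I s -> `|f n s| <= M) ->
  `|f 0%N t - \sum_(k < n) f k t0 * ((t - t0) ^+ k / k`!%:R)|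
    <= M * (`|t - t0| ^+ n / n`!%:R).
Proof.
move=> itvI It0 It Df fM.
(* The path is constant if [t = t0]; only the term [k = 0] of the sum survives. *)
have [<-{t It}|tt0] := eqVneq t0 t.
  rewrite subrr; case: n fM => [|n] fM.
    by rewrite big_ord0 subr0 expr0 fact0 divr1 mulr1 fM.
  rewrite big_ord_recl big1 => [|i _]; last by rewrite expr0n mul0r mulr0.
  by rewrite expr0 fact0 divr1 mulr1 addr0 subrr normr0 expr0n mul0r mulr0.
pose d := t - t0; have d0 : d != 0 by rewrite subr_eq0 eq_sym.
have II s : s \in `[0, 1]%R -> I (t0 + s * d).
  rewrite in_itv /= => /andP[s0 s1]; rewrite /d.
  have [le|/ltW le] := leP t0 t.
    by apply: (itvI _ _ It0 It); apply/andP; split; nra.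
  by apply: (itvI _ _ It It0); apply/andP; split; nra.
(* The factor [d ^+ k] comes from the chain rule and makes [F k.+1] the derivative of [F k]. *)
pose F k s := f k (t0 + s * d) * d ^+ k.
have DF k s : s \in `[0, 1]%R -> has_derive_on `[0, 1]%classic (F k) s (F k.+1 s).
  move=> s01.
  have := @has_derive_on_affine I `[0, 1]%classic (f k) t0 d s _ d0 II
    (Df k _ (II _ s01)).
  move=> H; rewrite /has_derive_on.
  have -> : diff_quotient (F k) s =
     (fun y => diff_quotient (fun s => f k (t0 + s * d)) s y * d ^+ k).
    by apply/funext => y; rewrite /diff_quotient /F; ring.
  have -> : F k.+1 s = f k.+1 (t0 + s * d) * d * d ^+ k.
    by rewrite /F exprS mulrA.
  by apply: cvgM; [exact: H|exact: cvg_cst].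
have := @taylor_unit_itv R n F (M * `|d| ^+ n) _ _ _ 1 _.
have -> : F 0%N 1 = f 0%N t by rewrite /F expr0 mulr1 /d; congr f; ring.
rewrite /F expr1n.
rewrite (eq_bigr (fun k : 'I_n => f k t0 * (d ^+ k / k`!%:R))); last first.
  by move=> k _; rewrite expr1n mul0r addr0; ring.
rewrite mulrA mulr1 mulrA; apply.
- move=> k s s01; apply: (@has_derive_on_interior `[0, 1]%classic).
    apply: (@filterS _ _ _ `]0, 1[%classic); first exact: subset_itv_oo_cc.
    exact: near_in_itvoo.
  by apply: DF; exact: subset_itv_oo_cc.
- by move=> k; apply: (@has_derive_on_continuous _ _ (F k.+1)) => s; exact: DF.
- move=> s s01; rewrite /F normrM normrX ler_wpM2r ?exprn_ge0//.
  exact/fM/II.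
- by rewrite in_itv /= ler01 lexx.
Qed.

End RelativeDerivative.

(** * Decay of the bound on the Taylor remainder *)

Section Ratio.
Context {R : realType}.
Implicit Types (A c q : R).

(** From [N] on, the sequence is dominated by a geometric one of ratio [q]. *)
Lemma ratio_test_cvg0 (b : nat -> R) q N : 0 <= q < 1 ->
  (forall n, 0 <= b n) -> (forall n, (N <= n)%N -> b n.+1 <= q * b n) ->
  b @ \oo --> 0.
Proof.
move=> /andP[q0 q1] b0 bq; rewrite -(cvg_shiftn N).
have bN n : b (n + N)%N <= b N * q ^+ n.
  elim: n => [|n IH]; first by rewrite expr0 mulr1.
  rewrite addSn (le_trans (bq _ _)) ?leq_addl// exprS mulrCA.
  by rewrite ler_wpM2l.
apply: (@squeeze_cvgr _ _ _ _ (cst 0) (fun n => b N * q ^+ n)).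
- by near=> n; rewrite b0 bN.
- exact: cvg_cst.
- by apply: cvg_geometric; rewrite ger0_norm.
Unshelve. all: by end_near. Qed.

Lemma exp_nlogn_le A m n : 0 <= A -> (m <= n)%N -> exp_nlogn A m <= exp_nlogn A n.
Proof.
move=> A0 mn; rewrite /exp_nlogn ler_expR ler_wpM2l//.
(* Zero is treated apart, since monotonicity of [ln] is available only on positive reals. *)
have [->|m0] := posnP m.
  rewrite mul0r; have [->|n0] := posnP n; first by rewrite mul0r.
  by rewrite mulr_ge0// ln_ge0// ler1n.
rewrite ler_pM// ?ler_nat// ?ln_ge0 ?ler1n//.
by rewrite ler_ln ?posrE ?ltr0n ?ler_nat// (leq_trans m0).
Qed.

(* The increment of [n ln n] is [ln (n + 1) + n ln (1 + 1 / n) <= ln (n + 1) + 1]. *)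
Lemma exp_nlognS A n : 0 <= A ->
  exp_nlogn A n.+1 <= expR (A * (ln n.+1%:R + 1)) * exp_nlogn A n.
Proof.
move=> A0; rewrite /exp_nlogn -expRD ler_expR -mulrDr ler_wpM2l//.
have [->|n0] := posnP n; first by rewrite mul0r addr0 mul1r lerDl.
have n0' : 0 < n%:R :> R by rewrite ltr0n.
have : ln (n.+1%:R / n%:R) <= n%:R^-1 :> R.
  have -> : n.+1%:R / n%:R = 1 + n%:R^-1 :> R.
    by rewrite -natr1 mulrDl mul1r divff// lt0r_neq0.
  by apply: le_ln1Dx; rewrite (lt_trans (ltrN10 _))// invr_gt0.
rewrite ln_div ?posrE ?ltr0n// => h.
have : n%:R * (ln n.+1%:R - ln n%:R) <= 1 :> R.
  by rewrite mulrC -ler_pdivlMr// div1r.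
by rewrite -natr1; nra.
Qed.

(** Divided by [n.+1], the left side bounds the ratio of consecutive terms in [exp_nlogn_fact_cvg0].
    It behaves like a multiple of [n] to the power [A - 1]: it tends to 0 if [A < 1] and to
    [c * expR 1] if [A = 1]. *)
Lemma growth_ratio_lt1 A c d : 0 < A <= 1 -> 0 <= c ->
  (A = 1 -> c * expR 1 < 1) ->
  exists q, 0 <= q < 1 /\ exists N, forall n, (N <= n)%N ->
    c * expR (A * (ln (n + d).+1%:R + 1)) <= q * n.+1%:R.
Proof.
move=> /andP[A0 A1] c0 cA.
have e0 : 0 < expR 1 :> R by exact: expR_gt0.
have E n : expR (1 * (ln (n + d).+1%:R + 1)) = (n + d).+1%:R * expR 1 :> R.
  by rewrite mul1r expRD lnK// posrE ltr0n.
have [Aeq|Aneq] := eqVneq A 1.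
  rewrite Aeq; have ce := cA Aeq.
  (* The midpoint of the limit and 1; the gap [(1 - c * expR 1) / 2] times [n] absorbs the shift by
     [d] once [n] exceeds [X]. *)
  exists ((c * expR 1 + 1) / 2); split; first by apply/andP; split; nra.
  have := archi_boundP (_ : 0 <= c * expR 1 * d%:R / ((1 - c * expR 1) / 2)).
  set X := c * expR 1 * d%:R / _; set N := Num.bound X => XN.
  exists N => n Nn; rewrite E.
  have : X <= n%:R.
    apply: le_trans (_ : N%:R <= _); last by rewrite ler_nat.
    by apply/ltW/XN; rewrite /X !mulr_ge0 ?invr_ge0//; nra.
  rewrite ler_pdivrMr; last lra.
  rewrite -addSn natrD -(natr1 n); nra.
have {Aneq}{}A1 : A < 1 by rewrite lt_neqAle Aneq.
exists 2^-1; split; first by apply/andP; split; lra.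
have d0 : 0 <= d%:R :> R by [].
(* Multiplying both sides by the exponential with exponent factor [1 - A] reduces to the explicit
   case [A = 1]. With this [K], and [n] so large that the multiplier exceeds [K], what remains is
   that [(n + d).+1] is at most [n.+1 * d.+1]. *)
pose K := 2 * c * expR 1 * d.+1%:R.
have K0 : 0 <= K by rewrite /K !mulr_ge0.
pose X := K / (1 - A).
exists (Num.bound (expR X)) => n Nn.
have {Nn} Xn : X <= ln (n + d).+1%:R.
  rewrite -ler_expR lnK ?posrE ?ltr0n//.
  apply: le_trans (ltW (archi_boundP (expR_ge0 X))) _.
  by rewrite ler_nat (leq_trans Nn)// -addnS leq_addr.
have {Xn} KX : K <= expR ((1 - A) * (ln (n + d).+1%:R + 1)).
  apply: le_trans (_ : (1 - A) * (ln (n + d).+1%:R + 1) <= _); last first.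
    by apply: le_trans (expR_ge1Dx _); rewrite lerDr.
  by move: Xn; rewrite /X ler_pdivrMr ?subr_gt0//; nra.
rewrite -(ler_pM2r (expR_gt0 ((1 - A) * (ln (n + d).+1%:R + 1)))).
rewrite -mulrA -expRD -mulrDl (addrC A) subrK E.
apply: le_trans (_ : 2^-1 * n.+1%:R * K <= _); last by rewrite ler_wpM2l.
have : ((n + d).+1 <= n.+1 * d.+1)%N by rewrite mulSn mulnS; lia.
rewrite -(ler_nat R) natrM /K => h.
have -> : 2^-1 * n.+1%:R * (2 * c * expR 1 * d.+1%:R) =
   c * (n.+1%:R * d.+1%:R * expR 1) :> R by field.
by rewrite ler_wpM2l// ler_wpM2r// ltW.
Qed.

(** Ratio test, with the increment bound [exp_nlognS]. Applied with [c] equal to [2 * D] times the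
    time lag, the condition for [A = 1] yields the radius. *)
Lemma exp_nlogn_fact_cvg0 A c d : 0 < A <= 1 -> 0 <= c ->
  (A = 1 -> c * expR 1 < 1) ->
  (fun n => c ^+ n * exp_nlogn A (n + d)%N / n`!%:R) @ \oo --> 0.
Proof.
move=> A01 c0 cA; have [q [q01 [N qN]]] := growth_ratio_lt1 d A01 c0 cA.
have A0 : 0 <= A by case/andP: A01 => /ltW.
apply: (ratio_test_cvg0 q01 (N := N)) => n.
  by rewrite divr_ge0// mulr_ge0 ?exprn_ge0// expR_ge0.
move=> /qN h; have f0 : 0 < n`!%:R :> R by rewrite ltr0n fact_gt0.
rewrite factS natrM invfM [leLHS]mulrA [leRHS]mulrA ler_pM2r ?invr_gt0//.
rewrite ler_pdivrMr ?ltr0n// exprSr -!mulrA.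
rewrite (mulrCA q) ler_wpM2l ?exprn_ge0//.
apply: le_trans (_ : c * (expR (A * (ln (n + d).+1%:R + 1)) *
  exp_nlogn A (n + d)) <= _); first by rewrite ler_wpM2l// exp_nlognS.
by rewrite mulrA [X in _ <= _ * X]mulrC mulrA ler_wpM2r// expR_ge0.
Qed.

End Ratio.

(** * Uniqueness of relative derivatives and their iterates *)

Section RelativeDerivativeLimits.
Context {R : realType}.
Implicit Types (I : set R) (f g : R -> R) (t l : R).

(** The points of the segment from [t] to [c] accumulate at [t] and stay in [I]. Properness of the
    filter makes limits unique, so that [lim] can be computed. *)
Lemma within_dnbhs_proper I t c : is_interval I -> I t -> I c -> c != t ->
  ProperFilter (within I t^').
Proof.
move=> itvI It Ic ct; apply: Build_ProperFilter_ex => P HP.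
have k : {for (0 : R), continuous (fun s : R => t + s * (c - t))}.
  by apply: cvgD; [exact: cvg_cst|apply: cvgM; [exact: cvg_id|exact: cvg_cst]].
have {}HP : \forall s \near (0 : R),
    t + s * (c - t) != t -> I (t + s * (c - t)) -> P (t + s * (c - t)).
  by apply: (k (fun y => y != t -> I y -> P y)); rewrite /= mul0r addr0; exact: HP.
suff : \forall s \near (0 : R)^'+, P (t + s * (c - t)).
  by move=> /filter_ex[s Ps]; exists (t + s * (c - t)).
near=> s.
have s0 : 0 < s by [].
have s1 : s < 1 by near: s; exact: nbhs_right_lt.
have : t + s * (c - t) != t -> I (t + s * (c - t)) -> P (t + s * (c - t)).
  by near: s; exact: cvg_at_right_filter HP.
apply.
  by rewrite -subr_eq0 addrC addKr mulf_neq0 ?subr_eq0// lt0r_neq0.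
have [le|/ltW le] := leP t c.
  by apply: (itvI _ _ It Ic); apply/andP; split; nra.
by apply: (itvI _ _ Ic It); apply/andP; split; nra.
Unshelve. all: by end_near. Qed.

Lemma eq_has_derive_on I f g t l : I t -> {in I, f =1 g} ->
  has_derive_on I f t l -> has_derive_on I g t l.
Proof.
move=> It fg; rewrite /has_derive_on => H.
have fgE s : I s -> f s = g s by move=> Is; apply: fg; rewrite inE.
apply: cvg_trans H; apply: near_eq_cvg.
suff : \forall s \near t, s != t -> I s ->
  diff_quotient f t s = diff_quotient g t s by [].
by near=> s => _ Is; rewrite /diff_quotient !fgE.
Unshelve. all: by end_near. Qed.

(** The iterated derivative agrees with [f k] on [I] only, so the induction step needs
    [eq_has_derive_on]. *)
Lemma derive_on_nE I (f : nat -> R -> R) k t :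
  (forall s, I s -> ProperFilter (within I s^')) ->
  (forall k s, I s -> has_derive_on I (f k) s (f k.+1 s)) -> I t ->
  derive_on_n I k (f 0%N) t = f k t.
Proof.
move=> pI Df; elim: k t => [//|k IH] t It.
have pt := pI t It.
apply: cvg_lim => //; apply: (@eq_has_derive_on _ (f k)) => //.
  by move=> s; rewrite inE => Is; rewrite -IH.
exact: Df.
Qed.

Lemma smooth_on_has_derive_on I (f : nat -> R -> R) :
  (forall s, I s -> ProperFilter (within I s^')) ->
  (forall k s, I s -> has_derive_on I (f k) s (f k.+1 s)) ->
  smooth_on I (f 0%N).
Proof.
move=> pI Df k t It; apply/cvg_ex; exists (f k.+1 t).
apply: (@eq_has_derive_on _ (f k)) => //; last exact: Df.
by move=> s; rewrite inE => Is; rewrite derive_on_nE.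
Qed.

End RelativeDerivativeLimits.

(** * Bounds for the Laplacian and its commutation with time derivatives *)

Section Laplacian.
Context {R : realType} {V : choiceType} (G : weighted_graph R V).
Implicit Types (f : V -> R) (x y p : V).

Let nbrs x := fset_set [set y | adj G x y].

Let nbrsE x y : (y \in nbrs x) = adj G x y.
Proof.
rewrite in_fset_set; last exact: adj_locally_finite.
by apply/idP/idP; rewrite inE.
Qed.

Lemma laplacianE f x : laplacian G f x =
  \sum_(y <- fset_set [set y | adj G x y]) omega G x y / mu G x * (f y - f x).
Proof.
apply: fsbigTE => y; rewrite nbrsE => xy.
by rewrite omega_eq0// !mul0r.
Qed.

Lemma weighted_degreeE x : weighted_degree G x =
  \sum_(y <- fset_set [set y | adj G x y]) omega G x y / mu G x.
Proof.
by apply: fsbigTE => y; rewrite nbrsE => xy; rewrite omega_eq0// mul0r.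
Qed.

(** Each difference [f y - f x] is at most [2 * B] in absolute value: this is the 2 in [2 * D]. *)
Lemma norm_laplacian_le f x B : `|f x| <= B ->
  (forall y, adj G x y -> `|f y| <= B) ->
  `|laplacian G f x| <= weighted_degree G x * (2 * B).
Proof.
move=> fx fy; rewrite laplacianE weighted_degreeE mulr_suml.
apply: le_trans (ler_norm_sum _ _ _) _; rewrite !big_seq.
apply: ler_sum => y; rewrite nbrsE => xy.
have w0 : 0 <= omega G x y / mu G x.
  by rewrite divr_ge0// ltW ?omega_gt0 ?mu_gt0.
rewrite normrM (ger0_norm w0) ler_wpM2l// mulr_natl mulr2n.
by rewrite (le_trans (ler_normB _ _))// lerD// fy.
Qed.

(** A shortest walk from [x] to [p], preceded by the edge from [y] to [x], joins [y] to [p].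
    Connectedness excludes the junk value of [dist]. *)
Lemma dist_adj_le x y p : connected_graph G -> adj G x y ->
  (dist G y p <= (dist G x p).+1)%N.
Proof.
move=> Gc xy; rewrite /dist.
case: pselect => [hy|[]]; last first.
  by have [n wn] := Gc y p; exists n; apply/asboolP.
case: pselect => [hx|[]]; last first.
  by have [n wn] := Gc x p; exists n; apply/asboolP.
case: (ex_minnP hx) => m /asboolP[s [ps ls sm]] _.
case: (ex_minnP hy) => n _; apply; apply/asboolP.
by exists (x :: s); rewrite /= adj_sym xy ps ls sm.
Qed.

Lemma norm_iter_laplacian_le D p (b : nat -> R) f k x : connected_graph G ->
  0 <= D -> (forall x, weighted_degree G x <= D) ->
  {homo b : m n / (m <= n)%N >-> m <= n} ->
  (forall x, `|f x| <= b (dist G x p)) ->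
  `|iter k (laplacian G) f x| <= (2 * D) ^+ k * b (k + dist G x p)%N.
Proof.
move=> Gc D0 GD bM fb; elim: k x => [|k IH] x.
  by rewrite expr0 mul1r add0n fb.
have D20 : 0 <= (2 * D) ^+ k by rewrite exprn_ge0// mulr_ge0.
(* A common bound at [x] and its neighbours: a neighbour is at most one step further from [p], and
   [b] is monotone. *)
set B := (2 * D) ^+ k * b (k.+1 + dist G x p)%N.
have xB : `|iter k (laplacian G) f x| <= B.
  by rewrite (le_trans (IH _))// ler_wpM2l// bM// leq_add2r.
have B0 : 0 <= B by apply: le_trans xB.
have -> : (2 * D) ^+ k.+1 * b (k.+1 + dist G x p)%N = D * (2 * B).
  by rewrite /B exprS; ring.
apply: le_trans (_ : weighted_degree G x * (2 * B) <= _); last first.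
  apply: ler_wpM2r; last exact: GD.
  exact: mulr_ge0.
apply: norm_laplacian_le => // y xy.
by rewrite (le_trans (IH _))// ler_wpM2l// bM// addSnnS leq_add2l dist_adj_le.
Qed.

(** By local finiteness the Laplacian is a finite sum, so the limit passes through it term by
    term. *)
Lemma has_derive_on_laplacian I (v : V -> R -> R) (dv : V -> R) t x :
  (forall y, has_derive_on I (v y) t (dv y)) ->
  has_derive_on I (fun s => laplacian G (v ^~ s) x) t (laplacian G dv x).
Proof.
move=> Dv; rewrite /has_derive_on laplacianE.
have -> : diff_quotient (fun s => laplacian G (v ^~ s) x) t =
    (fun s => \sum_(y <- nbrs x) omega G x y / mu G x *
      (diff_quotient (v y) t s - diff_quotient (v x) t s)).
  apply/funext => s; rewrite /diff_quotient !laplacianE -sumrB mulr_suml.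
  by apply: eq_bigr => y _; ring.
apply: cvg_big => [|y _]; first exact: add_continuous.
by apply: cvgM; [exact: cvg_cst|apply: cvgB; exact: Dv].
Qed.

End Laplacian.

(** * The time interval and the iterated heat equation *)

Section HeatEquation.
Context {R : realType} {V : choiceType}.
Implicit Types (T : \bar R) (u : V -> R -> R).

Lemma time_interval_is_interval T : is_interval (time_interval T).
Proof.
move=> x y [Tx _] [_ y0] z /andP[xz zy]; split; last exact: le_trans y0.
by apply: le_trans Tx _; rewrite lee_fin.
Qed.

Lemma time_interval0 T : (0 < T)%E -> time_interval T 0.
Proof. by move=> T0; split=> //; rewrite leeNl oppe0 ltW. Qed.

Lemma time_interval_proper T t : (0 < T)%E -> time_interval T t ->
  ProperFilter (within (time_interval T) t^').
Proof.
move=> T0 Tt.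
(* A second point of the interval: 0 unless [t = 0], and then [- T], or [-1] when [T] is
   infinite. *)
have [c [Tc ct]] : exists c, time_interval T c /\ c != t.
  have [t0|t0] := eqVneq t 0; last first.
    by exists 0; split; [exact: time_interval0|rewrite eq_sym].
  rewrite t0; case: T T0 {Tt} => [T| |]//; rewrite ?lte_fin => T0.
    exists (- T); split; last by rewrite oppr_eq0 gt_eqF.
    by split; [|rewrite oppr_le0 ltW].
  exists (-1); split; last by rewrite oppr_eq0 oner_eq0.
  by split; [rewrite leNye|rewrite lerN10].
exact: (within_dnbhs_proper (@time_interval_is_interval T) Tt Tc ct).
Qed.

(** The heat equation is the case [k = 0]; the time derivative commutes with each further
    Laplacian. *)
Lemma has_derive_on_heat (G : weighted_graph R V) T u k x t :
  heat_solution G T u -> time_interval T t ->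
  has_derive_on (time_interval T) (fun s => iter k (laplacian G) (u ^~ s) x) t
    (iter k.+1 (laplacian G) (u ^~ t) x).
Proof.
move=> Hu Tt; elim: k x => [|k IH] x; last exact: has_derive_on_laplacian.
have [/cvg_ex[l Hl] /subr0_eq E] := Hu x t Tt.
by rewrite /= -E /has_derive_on /derive_on; apply/cvgP/Hl.
Qed.

End HeatEquation.

Theorem corollary1p4 (R : realType) (V : choiceType) (G : weighted_graph R V)
    (Gconn : connected_graph G) (p : V) (T : \bar R) (T_gt0 : (0 < T)%E)
    (u : V -> R -> R) (u_heat : heat_solution G T u)
    (A1 A2 : R) (A1_gt0 : 0 < A1) (A2_gt0 : 0 < A2) (A2_le1 : A2 <= 1)
    (u_growth : forall x t, time_interval T t ->
       `|u x t| <= A1 * exp_nlogn A2 (dist G x p))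
    (D : R) (D_gt0 : 0 < D)
    (Deg_le : (ereal_sup [set (weighted_degree G x)%:E | x in [set: V]]
                 <= D%:E)%E) :
  exists r : \bar R,
    [/\ (0 < r)%E,
        analytic_in_time T r u,
        (A2 < 1 -> r = +oo%E),
        (A2 = 1 -> ((1 / (2 * expR 1 * D))%:E <= r)%E)
      & exists a : nat -> V -> R,
          [/\ (forall x t, (- r < t%:E)%E -> time_interval T t ->
                 [series a k x * (t ^+ k / k`!%:R)]_k @ \oo --> u x t),
              (forall k x, laplacian G (a k) x = a k.+1 x)
            & (forall k x, `|a k x| <=
                 A1 * (2 * D) ^+ k * exp_nlogn A2 (k + dist G x p)%N)]].
Proof.
have wdD x : weighted_degree G x <= D.
  by rewrite -lee_fin; move/ereal_supP : Deg_le; apply; exists x.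
have D0 : 0 <= D by exact: ltW.
have DD0 : 0 <= 2 * D by rewrite mulr_ge0.
pose f x k t := iter k (laplacian G) (u ^~ t) x.
have Df x k t : time_interval T t ->
    has_derive_on (time_interval T) (f x k) t (f x k.+1 t).
  exact: has_derive_on_heat.
have fM k x t : time_interval T t ->
    `|f x k t| <= A1 * (2 * D) ^+ k * exp_nlogn A2 (k + dist G x p)%N.
  move=> Tt; rewrite mulrAC mulrC.
  (* The constant [A1] is absorbed into the monotone function [b]. *)
  apply: (@norm_iter_laplacian_le _ _ G D p (fun n => A1 * exp_nlogn A2 n)) => //.
  - by move=> m n mn; rewrite ler_pM2l// exp_nlogn_le// ltW.
  - by move=> y; exact: u_growth.
have f_cvg x t0 t : time_interval T t0 -> time_interval T t ->
    (A2 = 1 -> 2 * D * `|t - t0| * expR 1 < 1) ->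
    [series f x k t0 * ((t - t0) ^+ k / k`!%:R)]_k @ \oo --> u x t.
  move=> Tt0 Tt small.
  have := @exp_nlogn_fact_cvg0 R A2 (2 * D * `|t - t0|) (dist G x p).
  rewrite A2_gt0 A2_le1 mulr_ge0// => /(_ isT isT small).
  move=> /(cvgMl_tmp (a := A1)).
  rewrite mulr0 => b0; apply/cvgrPdist_le => e e0.
  move/cvgrPdist_le : b0 => /(_ e e0) b0.
  near=> n.
  have bn : `|0 - A1 * ((2 * D * `|t - t0|) ^+ n * exp_nlogn A2 (n + dist G x p)
      / n`!%:R)| <= e by near: n.
  apply: le_trans bn.
  rewrite sub0r normrN; apply: le_trans (ler_norm _).
  rewrite /series /= big_mkord.
  (* The partial sum up to [n] is the Taylor polynomial at [t0], and the bound on [f x n] turns its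
     remainder into the null sequence above. *)
  apply: le_trans (taylor_has_derive_on (@time_interval_is_interval R T)
    Tt0 Tt (Df x) (fM n x)) _.
  rewrite [in leRHS]exprMn le_eqVlt; apply/orP; left; apply/eqP; ring.
(* For [A2 = 1], [small] shows that a time lag below [r] satisfies the convergence condition. *)
pose r : \bar R := if A2 == 1 then (1 / (2 * expR 1 * D))%:E else +oo%E.
have e0 : 0 < expR 1 :> R by exact: expR_gt0.
have small t : (`|t|%:E < r)%E -> A2 = 1 -> 2 * D * `|t| * expR 1 < 1.
  move=> + A21; rewrite /r A21 eqxx lte_fin ltr_pdivlMr ?mulr_gt0//.
  by congr (_ < _); ring.
have proper s : time_interval T s -> ProperFilter (within (time_interval T) s^').
  exact: time_interval_proper.
exists r; split.
- rewrite /r; case: ifP => // _.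
  by rewrite lte_fin divr_gt0// !mulr_gt0.
- move=> x.
  have dE k s : time_interval T s ->
      derive_on_n (time_interval T) k (f x 0%N) s = f x k s.
    by move=> Ts; apply: derive_on_nE => //; exact: Df.
  split; first by apply: (@smooth_on_has_derive_on _ _ (f x)) => //; exact: Df.
  move=> t0 t Tt0 Tt /small tr.
  have -> : (fun k => derive_on_n (time_interval T) k (u x) t0 *
      ((t - t0) ^+ k / k`!%:R)) = (fun k => f x k t0 * ((t - t0) ^+ k / k`!%:R)).
    by apply/funext => k; rewrite -dE.
  exact: f_cvg.
- by rewrite /r => /lt_eqF ->.
- by rewrite /r => ->; rewrite eqxx.
(* The coefficients are the iterated Laplacians of [u] at time 0, so the recursion holds by
   definition of [iter]. *)
- exists (fun k x => f x k 0); split => //.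
  + move=> x t rt Tt; have := f_cvg x 0 t (time_interval0 T_gt0) Tt.
    rewrite subr0; apply; apply: small.
    rewrite ler0_norm; last by case: Tt.
    by rewrite EFinN lteNl.
  + by move=> k x; apply: fM; exact: time_interval0.
Unshelve. all: by end_near. Qed.
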